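(* Let $n$ and $r$ be integers with $2 \le r \le n$. Among all simple connected graphs of order $n$ whose adjacency matrix has rank $r$, the Turán graph $T(n,r)$ is the unique graph attaining the maximum spectral radius; that is, every such graph $G$ satisfies $\rho(G) \le \rho(T(n,r))$, with equality if and only if $G \cong T(n,r)$.
   Context: For a graph $G$, $A(G)$ is its adjacency matrix, the rank of $G$ is the rank of $A(G)$, and the spectral radius $\rho(G)$ is the largest eigenvalue of $A(G)$. The Turán graph $T(n,r)$ is the complete $r$-partite graph on $n$ vertices whose part sizes are as equal as possible (each part has $\lfloor n/r\rfloor$ or $\lceil n/r\rceil$ vertices). Graphs are simple, undirected and (as a standing convention of the paper) connected. *)

(* Defs.v *)
From HB Require Import structures.
From mathcomp Require Import all_boot all_order all_algebra.
From mathcomp Require Import boolp classical_sets reals.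
From mathcomp Require complex polyrcf spectral.

Set Implicit Arguments.
Unset Strict Implicit.
Unset Printing Implicit Defensive.

Import complex Order.TTheory GRing.Theory Num.Theory.

Local Open Scope classical_set_scope.
Local Open Scope ring_scope.

Record sgraph := SGraph {
  vertex :> finType;
  edge : rel vertex;
  edge_sym : symmetric edge;
  edge_irr : irreflexive edge }.

Definition gorder (G : sgraph) : nat := #|G|.

Definition connected_graph (G : sgraph) : Prop :=
  (0 < gorder G)%N /\ forall x y : G, connect (@edge G) x y.

Definition isomorphic (G H : sgraph) : Prop :=
  exists2 f : G -> H, bijective f & {mono f : x y / edge x y}.

Definition adjacency (R : realType) (G : sgraph) : 'M[R]_(gorder G) :=
  \matrix_(i, j) (edge (enum_val i) (enum_val j))%:R.

Definition graph_rank (R : realType) (G : sgraph) : nat :=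
  \rank (adjacency R G).

(* A matrix has finitely many eigenvalues, so this supremum is a maximum as
   soon as there is an eigenvalue; see spectral_radiusP. *)
Definition spectral_radius (R : realType) (G : sgraph) : R :=
  sup [set x : R | eigenvalue (adjacency R G) x].

(* The parts are the residue classes modulo r; see turan_part_card. *)
Definition turan_edge (n r : nat) : rel 'I_n :=
  fun i j => (i %% r != j %% r)%N.

Lemma turan_edge_sym n r : symmetric (@turan_edge n r).
Proof. by move=> i j; rewrite /turan_edge eq_sym. Qed.

Lemma turan_edge_irr n r : irreflexive (@turan_edge n r).
Proof. by move=> i; rewrite /turan_edge eqxx. Qed.

Definition turan (n r : nat) : sgraph :=
  SGraph (@turan_edge_sym n r) (@turan_edge_irr n r).

Lemma turan_part_card (n r k : nat) : (k < r)%N ->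
  #|[pred i : turan n r | (i %% r == k)%N]| = (n %/ r + (k < n %% r))%N.
Proof.
move=> kr; have r0 : (0 < r)%N by apply: leq_ltn_trans kr.
rewrite -sum1_card big_mkcond /=.
elim: n => [|n IHn]; first by rewrite big_ord0 div0n mod0n.
rewrite big_ord_recr /= {}IHn inE /=.
set q := (n %/ r)%N; set s := (n %% r)%N.
have sr : (s < r)%N by rewrite ltn_mod.
have -> : n.+1 = (q * r + s.+1)%N by rewrite addnS -divn_eq.
rewrite divnMDl // modnMDl; have [lt|ge] := ltnP s.+1 r.
  rewrite divn_small // modn_small // addn0 ltnS -addnA.
  by case: (ltngtP k s).
have -> : s.+1 = r by apply/eqP; rewrite eqn_leq sr.
rewrite divnn modnn r0 ltn0 addn0 -addnA; congr (_ + _)%N.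
by move: (leq_trans kr ge); rewrite ltnS; case: (ltngtP k s).
Qed.

Lemma adjacency_eigenvalue_ex (R : realType) (G : sgraph) :
  (0 < gorder G)%N -> exists x : R, eigenvalue (adjacency R G) x.
Proof.
move=> G0; pose C : numClosedFieldType := complex.complex R.
pose f : {rmorphism R -> C} := @complex.real_complex R.
pose A := map_mx f (adjacency R G).
have Asym : A^T = A.
  by apply/matrixP => i j; rewrite !mxE edge_sym.
have Acj : map_mx Num.conj A = A.
  by apply/matrixP => i j; rewrite !mxE !rmorph_nat.
have [a Aa] : exists a, eigenvalue A a := spectral.eigenvalue_closed A G0.
have /eigenvalueP[v vA v0] := Aa.
have aR : a \is Num.real.
  pose w := (map_mx Num.conj v)^T.
  have Aw : A *m w = a^* *: w.
    by rewrite /w -{1}Asym -trmx_mul -{1}Acj -map_mxM vA map_mxZ linearZ.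
  have vw : (v *m w) 0 0 != 0.
    rewrite mxE psumr_eq0 => [|i _]; last by rewrite !mxE -normCK exprn_ge0.
    apply: contra v0 => /allP h; apply/eqP/rowP => i; apply/eqP.
    have := h i (mem_index_enum i).
    by rewrite /= !mxE -normCK sqrf_eq0 normr_eq0.
  apply/CrealP/(mulIf vw).
  have : v *m A *m w = v *m (A *m w) by rewrite mulmxA.
  by rewrite vA Aw -scalemxAl -scalemxAr => /matrixP/(_ 0 0);
    rewrite [LHS]mxE [RHS]mxE.
have /complex.complex_realP[x ax] := aR.
exists x; move: Aa; rewrite !eigenvalue_root_char ax -map_char_poly.
by rewrite (fmorph_root f).
Qed.

Lemma spectral_radiusP (R : realType) (G : sgraph) : (0 < gorder G)%N ->
  eigenvalue (adjacency R G) (spectral_radius R G) /\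
  forall x : R, eigenvalue (adjacency R G) x -> x <= spectral_radius R G.
Proof.
move=> /(adjacency_eigenvalue_ex R)[x0 Ax0].
set A := adjacency R G in Ax0 *.
have p0 : char_poly A != 0 by rewrite -size_poly_eq0 size_char_poly.
have [m Am mub] : exists2 m, eigenvalue A m & forall x, eigenvalue A x -> x <= m.
  have eE x : eigenvalue A x = (x \in polyrcf.rootsR (char_poly A)).
    by rewrite eigenvalue_root_char -(polyrcf.roots_on_rootsR p0) in_itv.
  have : exists2 m, m \in polyrcf.rootsR (char_poly A)
      & forall x, x \in polyrcf.rootsR (char_poly A) -> x <= m.
    rewrite eE in Ax0; elim: (polyrcf.rootsR _) x0 Ax0 => // y [|z s] IH _ _.
      by exists y => [|x]; rewrite ?inE // => /eqP->.
    have [m ms mub] := IH z (mem_head _ _).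
    have [le|lt] := leP y m.
      exists m => [|x]; first by rewrite inE ms orbT.
      by rewrite inE => /orP[/eqP->//|/mub].
    exists y => [|x]; first exact: mem_head.
    rewrite inE => /orP[/eqP->//|/mub xm]; exact: le_trans xm (ltW lt).
  by move=> [m ms mub]; exists m => [|x]; rewrite eE //; apply: mub.
suff -> : spectral_radius R G = m by [].
apply/eqP; rewrite eq_le /spectral_radius; apply/andP; split.
  by apply: ge_sup; [exists m | move=> x; apply: mub].
by apply: ub_le_sup => //; exists m => x; apply: mub.
Qed.

(* Main.v *)
Require Import Defs.
From mathcomp Require Import all_boot all_order all_algebra.
From mathcomp Require Import reals.
From mathcomp Require Import ring lra zify.

Set Implicit Arguments.
Unset Strict Implicit.
Unset Printing Implicit Defensive.

Import Order.TTheory GRing.Theory Num.Theory.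

Local Open Scope ring_scope.

(* A graph of rank r has no clique of order r + 1, because complete graphs of
   order at least 2 are nonsingular; so the theorem is an instance of the
   spectral Turan theorem. Let a > 0 be the spectral radius of G, and let x be
   the entrywise absolute value of an eigenvector, so that a x <= A x. Erdos's
   degree majorization, weighted by x, gives a partition of the vertices into r
   parts with a x_v <= sum of x_u over u outside the part of v. Summing over
   each part, of size k_i, yields 1 <= sum_i k_i / (a + k_i). By strict
   concavity of k |-> k / (a + k) this sum is at most its value for the
   balanced sizes, with equality only for balanced sizes. As the Turan graph
   has eigenvalue t as soon as its own sum at t is 1 (with eigenvector
   1 / (t + size of the part)), the intermediate value theorem gives such a
   t >= a. Equality throughout forces G to be the Turan graph. *)

(** Each fibre is enumerated, and an element goes to the one at the same index in the fibre of [f2]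
    with the same colour. *)
Lemma bijective_of_fiber_card (T1 T2 : finType) (C : eqType)
    (f1 : T1 -> C) (f2 : T2 -> C) :
  #|T1| = #|T2| ->
  (forall c, #|[pred x | f1 x == c]| = #|[pred y | f2 y == c]|) ->
  exists2 g : T1 -> T2, bijective g & forall x, f2 (g x) = f1 x.
Proof.
move=> cT cF.
pose e1 c := enum [pred x | f1 x == c]; pose e2 c := enum [pred y | f2 y == c].
have s12 c : size (e1 c) = size (e2 c) by rewrite -!cardE cF.
have idx x : (index x (e1 (f1 x)) < size (e2 (f1 x)))%N.
  by rewrite -s12 index_mem mem_enum inE.
(* A default for [nth], extracted from the nonempty fibre of [f2] over [f1 x]. *)
have d (x : T1) : T2.
  by case: (e2 (f1 x)) (idx x) => [|y]; rewrite ?ltn0.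
pose g x := nth (d x) (e2 (f1 x)) (index x (e1 (f1 x))).
have gf x : f2 (g x) = f1 x.
  by have := mem_nth (d x) (idx x); rewrite mem_enum inE => /eqP.
exists g => //; apply: inj_card_bij; last by rewrite cT.
move=> x y gxy; have fxy : f1 x = f1 y by rewrite -!gf gxy.
have ix : (index y (e1 (f1 x)) < size (e2 (f1 x)))%N by rewrite fxy idx.
move: gxy; rewrite /g -fxy (set_nth_default (d x) _ ix) => /eqP.
rewrite nth_uniq ?enum_uniq // => /eqP.
by apply: (@index_inj _ x (e1 (f1 x))); rewrite mem_enum inE ?fxy.
Qed.

(** * Eigenvectors as functions on the vertices *)

Section Eigenfunctions.
Variables (R : realType).

Lemma eigenvalue_adjacencyP (G : sgraph) (a : R) :
  eigenvalue (adjacency R G) a <->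
  exists2 f : G -> R, exists v, f v != 0
    & forall v, \sum_(u | edge u v) f u = a * f v.
Proof.
have sumE (f : G -> R) v : \sum_(u | edge u v) f u =
    \sum_(i < gorder G) f (enum_val i) * (edge (enum_val i) v)%:R.
  rewrite big_mkcond (reindex (fun i : 'I_(gorder G) => enum_val i)) /=; last exact/onW_bij/enum_val_bij.
  by apply: eq_bigr => i _; case: ifP; rewrite ?mulr1 ?mulr0.
split=> [/eigenvalueP[w wA w0]|[f [v0 fv0] fE]].
  exists (fun v => w 0 (enum_rank v)).
    have /existsP[i wi] : [exists i, w 0 i != 0].
      apply: contraNT w0 => /existsPn h; apply/eqP/rowP => i.
      by rewrite mxE; apply/eqP; have := h i; rewrite negbK.
    by exists (enum_val i); rewrite enum_valK.
  move=> v; rewrite sumE; have /rowP/(_ (enum_rank v)) := wA.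
  rewrite !mxE => <-; apply: eq_bigr => i _.
  by rewrite !mxE enum_rankK enum_valK.
apply/eigenvalueP; exists (\row_i f (enum_val i)).
  apply/rowP => j; rewrite !mxE -fE sumE.
  by apply: eq_bigr => i _; rewrite !mxE.
apply/eqP => /rowP/(_ (enum_rank v0)); rewrite !mxE enum_rankK => /eqP.
exact/negP.
Qed.

Lemma isomorphic_eigenvalue (G H : sgraph) (a : R) : isomorphic G H ->
  eigenvalue (adjacency R H) a -> eigenvalue (adjacency R G) a.
Proof.
move=> [h hb hm] /eigenvalue_adjacencyP[f [v fv] fE].
apply/eigenvalue_adjacencyP; exists (f \o h).
  by have [k kK hK] := hb; exists (k v); rewrite /= hK.
move=> w; rewrite /= -fE [RHS](reindex h) /=; last exact: onW_bij.
by apply: eq_bigl => u; rewrite hm.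
Qed.

Lemma isomorphic_sym (G H : sgraph) : isomorphic G H -> isomorphic H G.
Proof.
move=> [h [k kK hK] hm]; exists k; first by exists h.
by move=> x y; rewrite -hm !hK.
Qed.

Lemma isomorphic_spectral_radius (G H : sgraph) :
  (0 < gorder G)%N -> isomorphic G H ->
  spectral_radius R G = spectral_radius R H.
Proof.
move=> G0 GH; have H0 : (0 < gorder H)%N.
  by have [h hb _] := GH; rewrite /gorder -(bij_eq_card hb).
have [eG mG] := spectral_radiusP R G0; have [eH mH] := spectral_radiusP R H0.
apply/eqP; rewrite eq_le mH ?mG //; first exact: isomorphic_eigenvalue GH eH.
exact: isomorphic_eigenvalue (isomorphic_sym GH) eG.
Qed.

(* The absolute values of an eigenvector form a subeigenvector, which is all
   of the Perron-Frobenius theorem that is needed. *)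
Lemma nonneg_subeigenfunction (G : sgraph) (a : R) : 0 <= a ->
  eigenvalue (adjacency R G) a ->
  exists2 x : G -> R, (forall v, 0 <= x v) /\ 0 < \sum_v x v
    & forall v, a * x v <= \sum_(u | edge u v) x u.
Proof.
move=> a0 /eigenvalue_adjacencyP[f [v fv] fE].
exists (fun v => `|f v|).
  split=> [w|]; first exact: normr_ge0.
  rewrite (bigD1 v) //= ltr_wpDr ?normr_gt0 //.
  by apply: sumr_ge0 => w _; apply: normr_ge0.
by move=> w; rewrite -{1}(ger0_norm a0) -normrM -fE; apply: ler_norm_sum.
Qed.

End Eigenfunctions.

(** * Cliques and the rank of the adjacency matrix *)

Section Rank.
Variable R : realType.

Definition clique (G : sgraph) (K : {set G}) :=
  {in K &, forall u v, u != v -> edge u v}.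

Lemma row_free_complete_graph (k : nat) : (k != 1)%N ->
  row_free (\matrix_(i < k, j < k) (i != j)%:R : 'M[R]_k).
Proof.
move=> k1; rewrite -kermx_eq0; apply/eqP/row_matrixP => i.
set M := \matrix_(_, _) _; rewrite row0.
have : row i (kermx M) *m M = 0 by rewrite -row_mul mulmx_ker row0.
move: (row i _) => w /rowP wM; pose s := \sum_j w 0 j.
(* Column [j] says that the entries other than [w 0 j] sum to 0. All entries thus equal [s], so
   [k * s = s], and [s = 0] because [k != 1]. *)
have ws j : w 0 j = s.
  have := wM j; rewrite !mxE => /eqP; rewrite (bigD1 j) //= mxE eqxx mulr0 add0r.
  rewrite (eq_bigr (fun l => w 0 l)); last first.
    by move=> l lj; rewrite mxE lj mulr1.
  by move=> /eqP e; rewrite /s (bigD1 j) //= e addr0.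
have /eqP : s *+ k = s.
  by rewrite {2}/s (eq_bigr (fun=> s)) // sumr_const card_ord.
rewrite -subr_eq0 -[X in _ - X]mulr1 -mulr_natr -mulrBr mulf_eq0.
rewrite subr_eq0 pnatr_eq1 (negPf k1) orbF => /eqP s0.
by apply/rowP => j; rewrite ws s0 mxE.
Qed.

Lemma rank_mxsub_le (m n k l : nat) (f : 'I_k -> 'I_m) (g : 'I_l -> 'I_n)
    (A : 'M[R]_(m, n)) : (\rank (mxsub f g A) <= \rank A)%N.
Proof.
have -> : mxsub f g A = colsub g (rowsub f A).
  by apply/matrixP => i j; rewrite !mxE.
rewrite -[colsub g _]trmxK mxrank_tr.
have -> : (colsub g (rowsub f A))^T = rowsub g (rowsub f A)^T.
  by apply/matrixP => i j; rewrite !mxE.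
rewrite (leq_trans (mxrankS (rowsub_sub _ _))) // mxrank_tr.
exact: mxrankS (rowsub_sub _ _).
Qed.

(** A clique gives a principal submatrix that is the nonsingular adjacency matrix of a complete
    graph. A single vertex gives the zero matrix of order 1, hence the exception. *)
Lemma clique_card_le_rank (G : sgraph) (K : {set G}) :
  clique K -> (#|K| != 1)%N -> (#|K| <= graph_rank R G)%N.
Proof.
move=> cK K1; have /eqP <- := row_free_complete_graph K1.
set M := \matrix_(_, _) _.
have -> : M = mxsub (fun i : 'I_#|K| => enum_rank (enum_val i))
                    (fun i => enum_rank (enum_val i)) (adjacency R G).
  apply/matrixP => i j; rewrite !mxE !enum_rankK; congr (nat_of_bool _)%:R.
  have [->|ij] := eqVneq i j; first by rewrite edge_irr.
  by rewrite cK ?enum_valP // (inj_eq enum_val_inj).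
exact: rank_mxsub_le.
Qed.

End Rank.

(** * Weighted degree majorization by a complete multipartite graph *)

Section Majorization.
Variables (R : realType) (G : sgraph) (x : G -> R).
Hypothesis x_ge0 : forall v, 0 <= x v.

(* The colour classes are found greedily: give one colour to the vertices of S
   outside the neighbourhood of a vertex u of maximal weighted degree, and
   recurse on that neighbourhood, in which cliques are smaller. *)
Lemma multipartite_majorization (k : nat) (S : {set G}) :
  (forall K : {set G}, K \subset S -> clique K -> (#|K| <= k)%N) ->
  exists p : G -> nat, [/\ forall v, v \in S -> (p v < k)%N,
    forall v, v \in S -> \sum_(u in S | edge u v) x u
                         <= \sum_(u in S | p u != p v) x u
  & (forall v, v \in S -> 0 < x v) ->
    (forall v, v \in S -> \sum_(u in S | edge u v) x u
                          = \sum_(u in S | p u != p v) x u) ->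
    {in S &, forall u v, edge u v = (p u != p v)}].
Proof.
elim: k S => [|k IH] S cS.
  suff S0 v : (v \in S) = false by exists (fun=> 0%N); split=> [v|v|_ _ v w]; rewrite S0.
  apply/negP => vS; have := cS [set v]; rewrite sub1set vS cards1.
  move=> /(_ isT); suff cv : clique [set v] by move=> /(_ cv).
  by move=> a b /set1P-> /set1P->; rewrite eqxx.
have [->|[u0 u0S]] := set_0Vmem S.
  by exists (fun=> 0%N); split=> [v|v|_ _ v w]; rewrite inE.
pose d v := \sum_(u in S | edge u v) x u.
have [u uS dmax] : exists2 u, u \in S & forall v, v \in S -> d v <= d u.
  by case: (@arg_maxP _ _ _ u0 (mem S) d u0S) => u uS um; exists u.
pose N := [set v in S | edge v u].
have NS v : v \in N -> v \in S by rewrite inE => /andP[].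
have [p [pk pd pe]] : exists p : G -> nat, [/\ forall v, v \in N -> (p v < k)%N,
    forall v, v \in N -> \sum_(u in N | edge u v) x u
                         <= \sum_(u in N | p u != p v) x u
  & (forall v, v \in N -> 0 < x v) ->
    (forall v, v \in N -> \sum_(u in N | edge u v) x u
                          = \sum_(u in N | p u != p v) x u) ->
    {in N &, forall u v, edge u v = (p u != p v)}].
  apply: IH => K KN cK.
  have uK : u \notin K.
    by apply/negP => /(subsetP KN); rewrite inE edge_irr andbF.
  have : (#|u |: K| <= k.+1)%N.
    apply: cS.
      by rewrite subUset sub1set uS; apply/subsetP => v /(subsetP KN)/NS.
    have uv v : v \in K -> edge u v.
      by move=> /(subsetP KN); rewrite inE edge_sym => /andP[].
    move=> a b /setU1P[->|aK] /setU1P[->|bK]; rewrite ?eqxx // => ab.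
    - exact: uv.
    - by rewrite edge_sym uv.
    - exact: cK.
  by rewrite cardsU1 uK.
(* The recursion on [N] uses colours below [k], so [k] is new. *)
pose q v := if v \in N then p v else k.
have sumS (P : pred G) : \sum_(w in S | P w) x w =
    \sum_(w in N | P w) x w + \sum_(w in S :\: N | P w) x w.
  rewrite (bigID (mem N)) /=; congr (_ + _); apply: eq_bigl => w.
    by rewrite andbAC; case wN: (w \in N); rewrite ?andbF // (NS _ wN).
  by rewrite in_setD andbC andbA.
have qN v : v \in N -> \sum_(w in S | q w != q v) x w =
    \sum_(w in N | p w != p v) x w + \sum_(w in S :\: N) x w.
  move=> vN; rewrite sumS; congr (_ + _); apply: eq_bigl => w.
    by rewrite /q vN; case: (w \in N).
  rewrite /q vN in_setD; case: (w \in N) => //=.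
  by rewrite (gtn_eqF (pk v vN)) andbT.
(* Seen from outside [N], the other colours make up exactly [N], of weight [d u]; the maximality of
   [d u] then bounds [d v]. *)
have qM v : v \in S -> v \notin N -> \sum_(w in S | q w != q v) x w = d u.
  move=> vS vN; rewrite sumS [X in _ + X]big1 ?addr0.
    apply: eq_bigl => w; rewrite /q (negPf vN) andbC; case wN: (w \in N).
      by rewrite (ltn_eqF (pk w wN)); move: wN; rewrite inE => ->.
    by move: wN; rewrite inE eqxx => ->.
  move=> w; rewrite in_setD /q (negPf vN); case: (w \in N) => //=.
  by rewrite eqxx andbF.
have rest v : \sum_(w in S :\: N | edge w v) x w <= \sum_(w in S :\: N) x w.
  by rewrite big_mkcondr /=; apply: ler_sum => w _; case: ifP.
exists q; split=> [v vS|v vS|xpos eqd].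
- by rewrite /q; case: ifP => // vN; rewrite ltnS ltnW // pk.
- have [vN|vN] := boolP (v \in N); last by rewrite qM // dmax.
  by rewrite qN // sumS lerD // pd.
have eqN v : v \in N ->
    \sum_(w in N | edge w v) x w = \sum_(w in N | p w != p v) x w /\
    \sum_(w in S :\: N | edge w v) x w = \sum_(w in S :\: N) x w.
  move=> vN; have := eqd v (NS _ vN); rewrite qN // sumS.
  by have := pd v vN; have := rest v; lra.
(* As weights are positive, a missing edge between [N] and its complement in [S] would make [rest]
   strict. *)
have full v w : v \in N -> w \in S -> w \notin N -> edge w v.
  move=> vN wS wN; apply/negPn/negP => nwv.
  have [_] := eqN v vN; rewrite big_mkcondr /= => /eqP.
  rewrite eq_sym -subr_eq0 -sumrB psumr_eq0 => [/allP/(_ w (mem_index_enum _))|].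
    by rewrite in_setD wS wN (negPf nwv) subr0 gt_eqF ?xpos.
  by move=> z _; case: ifP => _; rewrite ?subrr ?subr0.
(* By [full], the neighbours of [v] in [N] already account for the whole weight [d u]. *)
have empty v w : v \in S -> v \notin N -> w \in S -> w \notin N -> edge w v = false.
  move=> vS vN wS wN; apply/negP => ewv.
  have := eqd v vS; rewrite qM // sumS.
  rewrite (eq_bigl (fun w => w \in N)) => [|z]; last first.
    by case zN: (z \in N) => //=; rewrite edge_sym full.
  rewrite [d u](eq_bigl (fun w => w \in N)) => [|z]; last by rewrite inE.
  move/eqP; rewrite -subr_eq0 addrC addKr psumr_eq0 // => /allP.
  move=> /(_ w (mem_index_enum _)); rewrite in_setD wS wN ewv /=.
  by rewrite gt_eqF ?xpos.
move=> v w vS wS; rewrite /q.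
case vN: (v \in N); case wN: (w \in N).
- by apply: pe => // [z /NS/xpos|z /eqN[]].
- by rewrite edge_sym full ?wN // ltn_eqF // pk.
- by rewrite full ?vN // gtn_eqF // pk.
- by rewrite empty ?vN ?wN // eqxx.
Qed.

End Majorization.

(** * The equation for the eigenvalue of a complete multipartite graph *)

Section Multipartite.
Variables (R : realType) (T J : finType) (p : T -> J).

Definition part_size (i : J) : nat := #|[pred u | p u == i]|.

(* The largest eigenvalue of the complete multipartite graph with parts
   [part_size i] is the positive root [a] of [part_sum a = 1]. *)
Definition part_sum (a : R) : R :=
  \sum_i (part_size i)%:R / (a + (part_size i)%:R).

Lemma sumr_const_part (c : R) (i : J) :
  \sum_(v | p v == i) c = c *+ part_size i.
Proof. by rewrite -sumr_const; apply: eq_bigl => v; rewrite inE. Qed.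

Lemma sum_part_size : \sum_i part_size i = #|T|.
Proof.
rewrite -sum1_card (partition_big p xpredT) //=; apply: eq_bigr => i _.
by rewrite sum1_card.
Qed.

Lemma part_size_gt0 v : (0 < part_size (p v))%N.
Proof. by apply/card_gt0P; exists v; rewrite inE. Qed.

Lemma part_sumE (a : R) :
  part_sum a = \sum_v (a + (part_size (p v))%:R)^-1.
Proof.
rewrite (partition_big p xpredT) //=; apply: eq_bigr => i _.
rewrite -[LHS]mulrC mulr_natr -sumr_const_part.
by apply: eq_bigr => v /eqP->.
Qed.

Lemma part_sum_root (a : R) : 0 <= a -> 1 <= part_sum a ->
  exists2 t, a <= t & part_sum t = 1.
Proof.
move=> a0 Sa; pose c v : R := (part_size (p v))%:R.
have c0 v : 0 < c v by rewrite ltr0n part_size_gt0.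
(* Clearing denominators in [1 - part_sum t] makes the intermediate value theorem for polynomials
   applicable. *)
pose P : {poly R} := \prod_v ('X + (c v)%:P)
                     - \sum_v \prod_(w | w != v) ('X + (c w)%:P).
have tc t v : 0 <= t -> t + c v != 0.
  by move=> t0; rewrite gt_eqF // ltr_wpDl.
have PE t : 0 <= t -> P.[t] = \prod_v (t + c v) * (1 - part_sum t).
  move=> t0; rewrite /P hornerD hornerN horner_prod horner_sum part_sumE.
  rewrite mulrBr mulr1 mulr_sumr; congr (_ - _).
    by apply: eq_bigr => v _; rewrite !hornerE.
  apply: eq_bigr => v _; rewrite horner_prod [in RHS](bigD1 v) //=.
  rewrite mulrAC mulfV ?tc // mul1r.
  by apply: eq_bigr => w _; rewrite !hornerE.
have pos t : 0 <= t -> 0 < \prod_v (t + c v).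
  by move=> t0; apply: prodr_gt0 => v _; rewrite ltr_wpDl.
(* At [b] each of the [#|T|] vertex terms is at most [1 / #|T|], so the sum is at most 1. *)
pose b := a + #|T|%:R.
have ab : a <= b by rewrite lerDl.
have b0 : 0 <= b := le_trans a0 ab.
have Sb : part_sum b <= 1.
  apply: (@le_trans _ _ (\sum_(v : T) #|T|%:R^-1)).
    rewrite part_sumE; apply: ler_sum => v _.
    have T0 : 0 < #|T|%:R :> R by rewrite ltr0n; apply/card_gt0P; exists v.
    rewrite -/(c v) lef_pV2 ?posrE ?(ltr_wpDl b0) //.
    by rewrite /b -addrA addrCA lerDl addr_ge0 // ltW.
  rewrite sumr_const -[X in X <= _]mulr_natr.
  by case: #|T| => [|m]; rewrite ?mulr0 // mulVf // pnatr_eq0.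
have [|t /andP[at_ _] /rootP] := @poly_ivt _ P a b ab.
  by rewrite !PE // pmulr_rle0 ?pos // pmulr_rge0 ?pos // subr_le0 Sa subr_ge0.
have t0 : 0 <= t := le_trans a0 at_.
rewrite PE // => /eqP; rewrite mulf_eq0 gt_eqF ?pos //= subr_eq0 eq_sym => /eqP.
by exists t.
Qed.

Variables (a : R) (x : T -> R).
Hypothesis a_gt0 : 0 < a.
Hypothesis x_gt0 : 0 < \sum_v x v.
Hypothesis x_sub : forall v, a * x v <= \sum_(u | p u != p v) x u.

(** With [X] the total weight, [Xi] that of the part and [k] its size, the slacks in the part add up
    to [k (X - Xi) - a Xi = k X - (a + k) Xi]. *)
Lemma part_weight_defect (i : J) :
  (\sum_v x v) * ((part_size i)%:R / (a + (part_size i)%:R))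
    - \sum_(v | p v == i) x v =
  (\sum_(v | p v == i) (\sum_(u | p u != p v) x u - a * x v))
    / (a + (part_size i)%:R).
Proof.
set X := \sum_v x v; set Xi := \sum_(v | p v == i) x v.
have an0 : a + (part_size i)%:R != 0 by rewrite gt_eqF // ltr_pwDl.
have XE : \sum_(u | p u != i) x u = X - Xi.
  by rewrite [X](bigID (fun u => p u == i)) /= -/Xi addrAC subrr add0r.
rewrite (eq_bigr (fun v => (X - Xi) - a * x v)); last first.
  by move=> v /eqP->; rewrite XE.
rewrite sumrB sumr_const_part -mulr_sumr -/Xi -mulr_natr.
by field.
Qed.

Lemma part_weight_defect_ge0 (i : J) :
  0 <= (\sum_v x v) * ((part_size i)%:R / (a + (part_size i)%:R))
    - \sum_(v | p v == i) x v.
Proof.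
rewrite part_weight_defect divr_ge0 //; last by rewrite addr_ge0 // ltW.
by apply: sumr_ge0 => v _; rewrite subr_ge0.
Qed.

Lemma sum_part_weight_defect :
  \sum_i ((\sum_v x v) * ((part_size i)%:R / (a + (part_size i)%:R))
    - \sum_(v | p v == i) x v) = (\sum_v x v) * (part_sum a - 1).
Proof.
rewrite sumrB -mulr_sumr mulrBr mulr1; congr (_ - _).
by rewrite [RHS](partition_big p xpredT).
Qed.

Lemma part_sum_ge1 : 1 <= part_sum a.
Proof.
rewrite -subr_ge0 -(pmulr_rge0 _ x_gt0) -sum_part_weight_defect.
by apply: sumr_ge0 => i _; apply: part_weight_defect_ge0.
Qed.

(** The nonnegative defects sum to 0, so every slack vanishes. Each part then has weight
    [X k / (a + k) < X], which leaves positive weight outside it and makes [x v] positive. *)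
Lemma part_sum_eq1 : part_sum a = 1 ->
  forall v, a * x v = \sum_(u | p u != p v) x u /\ 0 < x v.
Proof.
move=> S1.
have /eqP := sum_part_weight_defect; rewrite S1 subrr mulr0 psumr_eq0; last first.
  by move=> i _; apply: part_weight_defect_ge0.
move=> /allP d0 v; have := d0 (p v) (mem_index_enum _).
have an0 : 0 < a + (part_size (p v))%:R by rewrite ltr_pwDl.
have /eqP dv := d0 (p v) (mem_index_enum _).
rewrite part_weight_defect mulf_eq0 invr_eq0 (gt_eqF an0) orbF.
rewrite psumr_eq0 => [/allP/(_ v (mem_index_enum _))|u _]; last first.
  by rewrite subr_ge0.
rewrite eqxx subr_eq0 => /eqP xv; split=> //.
rewrite -(pmulr_rgt0 _ a_gt0) -xv.
have -> : \sum_(u | p u != p v) x u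
    = (\sum_v x v) - \sum_(u | p u == p v) x u.
  by rewrite [X in _ = X - _](bigID (fun u => p u == p v)) /= addrAC subrr add0r.
move/eqP: dv; rewrite subr_eq0 => /eqP <-.
rewrite -[X in X - _]mulr1 -mulrBr pmulr_rgt0 // subr_gt0.
by rewrite ltr_pdivrMr // mul1r ltrDr.
Qed.

End Multipartite.

(** For the vector [1 / (t + size)], whose entries sum to 1, the sum outside a part of size [k] is
    [1 - k / (t + k) = t / (t + k)]. *)
Lemma multipartite_eigenvalue (R : realType) (G : sgraph) (J : finType)
    (p : G -> J) (t : R) :
  (forall u v, edge u v = (p u != p v)) -> 0 <= t -> part_sum p t = 1 ->
  eigenvalue (adjacency R G) t.
Proof.
move=> ep t0 St; have tc v : 0 < t + (part_size p (p v))%:R.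
  by rewrite ltr_wpDl // ltr0n part_size_gt0.
apply/eigenvalue_adjacencyP.
exists (fun v => (t + (part_size p (p v))%:R)^-1).
  have [v _|G0] := pickP (pred_of_simpl (@predT G)).
    by exists v; rewrite invr_eq0 gt_eqF.
  have /eqP := St; rewrite part_sumE big1 ?(eq_sym 0) ?oner_eq0 // => v _.
  by have := G0 v.
move=> v; rewrite (eq_bigl (fun u => p u != p v)) => [|u]; last exact: ep.
have /eqP := St; rewrite part_sumE (bigID (fun u => p u == p v)) /=.
rewrite addrC eq_sym -subr_eq => /eqP <-.
rewrite (eq_bigr (fun=> (t + (part_size p (p v))%:R)^-1)); last first.
  by move=> u /eqP->.
rewrite sumr_const_part -mulr_natr; field; exact: lt0r_neq0.
Qed.

(** * Balanced sizes maximize the concave sum *)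

Section Balanced.
Variable R : realType.

(** The bound is the secant of [k / (a + k)] through [q] and [q.+1]. The gap is a positive multiple
    of [(k - q) (k - q - 1)], and no integer lies strictly between the two roots. *)
Lemma secant_leif (a : R) (q k : nat) : 0 < a ->
  k%:R / (a + k%:R) <=
    q%:R / (a + q%:R) + (k%:R - q%:R) * (a / ((a + q%:R) * (a + q.+1%:R)))
  ?= iff (k == q) || (k == q.+1).
Proof.
move=> a0; have p m : 0 < a + m%:R :> R by rewrite ltr_pwDl.
have n m : a + m%:R != 0 :> R by rewrite gt_eqF.
set L := q%:R / _ + _.
have LE : L - k%:R / (a + k%:R) =
    (k%:R - q%:R) * (k%:R - q.+1%:R)
    * (a / ((a + q%:R) * (a + q.+1%:R) * (a + k%:R))).
  by have := n q.+1; rewrite /L -natr1 => nq; field; rewrite ?n ?nq.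
have c0 : 0 < a / ((a + q%:R) * (a + q.+1%:R) * (a + k%:R)).
  by rewrite divr_gt0 // !mulr_gt0.
split.
  rewrite -subr_ge0 LE pmulr_lge0 //; have [kq|qk] := leqP k q.
    by rewrite mulr_le0 // subr_le0 ler_nat // ltnW.
  by rewrite mulr_ge0 // subr_ge0 ler_nat // ltnW.
rewrite eq_sym -subr_eq0 LE mulf_eq0 (gt_eqF c0) orbF mulf_eq0 !subr_eq0.
by rewrite !eqr_nat.
Qed.

(** The secant is affine, so its sum depends only on the total of the sizes; it is exact at every
    [m i]. *)
Lemma balanced_sum_leif (J : finType) (a : R) (q : nat) (k m : J -> nat) :
  0 < a -> (forall i, (m i == q) || (m i == q.+1)) ->
  \sum_i k i = \sum_i m i ->
  \sum_i (k i)%:R / (a + (k i)%:R) <= \sum_i (m i)%:R / (a + (m i)%:R)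
  ?= iff [forall i, (k i == q) || (k i == q.+1)].
Proof.
move=> a0 mq km.
have -> : \sum_i (m i)%:R / (a + (m i)%:R) = \sum_i
    (q%:R / (a + q%:R) + ((k i)%:R - q%:R) * (a / ((a + q%:R) * (a + q.+1%:R)))).
  transitivity (\sum_i (q%:R / (a + q%:R)
      + ((m i)%:R - q%:R) * (a / ((a + q%:R) * (a + q.+1%:R))))).
    apply: eq_bigr => i _; apply/eqP.
    by rewrite (secant_leif q (m i) a0).2 mq.
  by rewrite !big_split /= -!mulr_suml !sumrB -!natr_sum km.
by apply: leif_sum => i _; apply: secant_leif.
Qed.

End Balanced.

(** The total is [#|J| * q] plus the number of indices with value [q.+1], so it determines both
    counts. *)
Lemma two_valued_fiber_card (J : finType) (q : nat) (k m : J -> nat) :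
  (forall i, (k i == q) || (k i == q.+1)) ->
  (forall i, (m i == q) || (m i == q.+1)) ->
  (\sum_i k i = \sum_i m i)%N ->
  forall c, #|[pred i | k i == c]| = #|[pred i | m i == c]|.
Proof.
have sumE (f : J -> nat) : (forall i, (f i == q) || (f i == q.+1)) ->
    (\sum_i f i = #|J| * q + #|[pred i | f i == q.+1]|)%N.
  move=> fq; rewrite -sum_nat_const -sum1_card [X in (_ + X)%N]big_mkcond.
  rewrite -big_split /=; apply: eq_bigr => i _; rewrite inE.
  by have := fq i; case: eqP; case: eqP; lia.
have compl (f : J -> nat) : (forall i, (f i == q) || (f i == q.+1)) ->
    (#|[pred i | f i == q]| = #|J| - #|[pred i | f i == q.+1]|)%N.
  move=> fq; rewrite -(cardC [pred i | f i == q.+1]) addKn.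
  by apply: eq_card => i; rewrite !inE; have := fq i; case: eqP; case: eqP; lia.
have other (f : J -> nat) c : (forall i, (f i == q) || (f i == q.+1)) ->
    c != q -> c != q.+1 -> #|[pred i | f i == c]| = 0%N.
  move=> fq c0 c1; apply: eq_card0 => i; rewrite !inE.
  by apply/eqP => fc; have := fq i; rewrite fc (negPf c0) (negPf c1).
move=> kq mq; rewrite !sumE // => /addnI e c.
have [->|c1] := eqVneq c q.+1; first by [].
have [->|c0] := eqVneq c q; first by rewrite !compl // e.
by rewrite !other.
Qed.

(** * The Turán graph: connectedness, rank, spectral radius *)

Section Turan.
Variables (R : realType) (n r : nat).
Hypotheses (r_ge2 : (2 <= r)%N) (r_le_n : (r <= n)%N).

Let r_gt0 : (0 < r)%N := ltnW r_ge2.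

Definition turan_part (i : turan n r) : 'I_r := Ordinal (ltn_pmod i r_gt0).

Lemma turan_edgeE (u v : turan n r) : edge u v = (turan_part u != turan_part v).
Proof. by []. Qed.

Lemma part_size_turan (k : 'I_r) :
  part_size turan_part k = (n %/ r + (k < n %% r))%N.
Proof. by rewrite -turan_part_card. Qed.

Lemma part_size_turan_balanced (k : 'I_r) :
  ((part_size turan_part k == n %/ r)
   || (part_size turan_part k == (n %/ r).+1))%N.
Proof.
by rewrite part_size_turan; case: (k < _)%N; rewrite ?addn0 ?addn1 eqxx ?orbT.
Qed.

Lemma gorder_turan : gorder (turan n r) = n.
Proof. exact: card_ord. Qed.

Lemma gorder_turan_gt0 : (0 < gorder (turan n r))%N.
Proof. by rewrite gorder_turan (leq_trans r_gt0). Qed.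

Lemma connected_turan : connected_graph (turan n r).
Proof.
split=> [|x y]; first exact: gorder_turan_gt0.
have [exy|xy] := boolP (edge x y); first exact: connect1.
have n1 : (1 < n)%N := leq_trans r_ge2 r_le_n.
have n0 : (0 < n)%N := ltnW n1.
(* Nonadjacent vertices share a part, so a neighbour of one is a neighbour of both; vertex 0 or 1
   serves. *)
have [z xz] : exists z : turan n r, edge x z.
  have [x0|x0] := eqVneq (x %% r)%N 0%N.
    by exists (Ordinal n1); rewrite /edge /= /turan_edge x0 /= modn_small.
  by exists (Ordinal n0); rewrite /edge /= /turan_edge mod0n.
apply: (connect_trans (connect1 xz)); apply: connect1.
move: xy xz; rewrite !turan_edgeE negbK => /eqP->.
by rewrite eq_sym.
Qed.

(** The adjacency matrix factors through the [r] part indicators, and the first [r] vertices form a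
    clique. *)
Lemma graph_rank_turan : graph_rank R (turan n r) = r.
Proof.
apply/eqP; rewrite eqn_leq; apply/andP; split.
  pose B : 'M[R]_(gorder (turan n r), r) :=
    \matrix_(i, k) (turan_part (enum_val i) == k)%:R.
  pose C : 'M[R]_(r, gorder (turan n r)) :=
    \matrix_(k, j) (turan_part (enum_val j) != k)%:R.
  have BC : adjacency R (turan n r) = B *m C.
    apply/matrixP => i j; rewrite !mxE turan_edgeE.
    rewrite (bigD1 (turan_part (enum_val i))) //= !mxE eqxx mul1r big1 ?addr0.
      by rewrite eq_sym.
    by move=> k ki; rewrite !mxE eq_sym (negPf ki) mul0r.
  by rewrite /graph_rank BC (leq_trans (mxrankM_maxl _ _)) // rank_leq_col.
pose K : {set turan n r} := [set widen_ord r_le_n i | i : 'I_r].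
have cK : #|K| = r.
  rewrite card_imset ?card_ord // => i j /(congr1 val) /= ij; exact: val_inj.
rewrite -{1}cK; apply: clique_card_le_rank; last by rewrite cK gtn_eqF.
move=> _ _ /imsetP[i _ ->] /imsetP[j _ ->] ij; rewrite turan_edgeE.
apply: contra ij => /eqP/(congr1 val) /=; rewrite !modn_small // => ij.
by apply/eqP/val_inj.
Qed.

Lemma part_sum_turan0 : part_sum turan_part (0 : R) = r%:R.
Proof.
rewrite /part_sum (eq_bigr (fun=> 1)) ?sumr_const ?card_ord // => k _.
rewrite add0r divff // pnatr_eq0 part_size_turan -lt0n addn_gt0.
by rewrite divn_gt0 // r_le_n.
Qed.

(** The root [t >= a] of [part_sum t = 1] is an eigenvalue, so it lies between [a] and the spectral
    radius; if these agree, [a = t]. *)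
Lemma spectral_radius_turan_ge (a : R) : 0 <= a -> 1 <= part_sum turan_part a ->
  a <= spectral_radius R (turan n r)
  /\ (a = spectral_radius R (turan n r) -> part_sum turan_part a = 1).
Proof.
move=> a0 /(part_sum_root a0)[t at_ St].
have [_ /(_ t) tmax] := spectral_radiusP R gorder_turan_gt0.
have {tmax}tr := tmax (multipartite_eigenvalue turan_edgeE (le_trans a0 at_) St).
split=> [|ar]; first exact: le_trans at_ tr.
suff -> : a = t by [].
by apply/eqP; rewrite eq_le at_ ar.
Qed.

Lemma spectral_radius_turan_gt0 : 0 < spectral_radius R (turan n r).
Proof.
have [||ge0 eq1] := @spectral_radius_turan_ge 0 => //.
  by rewrite part_sum_turan0 ler1n.
rewrite lt_neqAle ge0 andbT; apply/eqP => /eq1 /eqP.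
by rewrite part_sum_turan0 pnatr_eq1 gtn_eqF.
Qed.

Lemma sum_part_size_turan (T : finType) (p : T -> 'I_r) : #|T| = n ->
  (\sum_i part_size p i = \sum_i part_size turan_part i)%N.
Proof. by move=> Tn; rewrite !sum_part_size card_ord. Qed.

Lemma balanced_isomorphic_turan (G : sgraph) (p : G -> 'I_r) :
  gorder G = n -> (forall u v, edge u v = (p u != p v)) ->
  (forall i, ((part_size p i == n %/ r) || (part_size p i == (n %/ r).+1))%N) ->
  isomorphic G (turan n r).
Proof.
move=> Gn ep bp.
(* First [s] matches parts of equal size, then [g] matches the vertices along [s]. *)
have [s sb sE] := bijective_of_fiber_card (erefl #|'I_r|)
  (two_valued_fiber_card bp part_size_turan_balanced (sum_part_size_turan p Gn)).
have [s' sK s'K] := sb.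
have [||g gb gE] := @bijective_of_fiber_card G (turan n r) _ (s \o p) turan_part.
- by rewrite -[LHS]/(gorder G) Gn card_ord.
- move=> c; rewrite -[c]s'K -[RHS]/(part_size turan_part _) sE.
  by apply: eq_card => v; rewrite !inE /= (inj_eq (can_inj sK)).
exists g => // u v.
by rewrite turan_edgeE !gE /= (inj_eq (can_inj sK)) ep.
Qed.

End Turan.

(** * The spectral Turán theorem *)

Section SpectralTuran.
Variables (R : realType) (n r : nat) (G : sgraph).
Hypotheses (r_ge2 : (2 <= r)%N) (r_le_n : (r <= n)%N).
Hypothesis G_order : gorder G = n.
Hypothesis G_free : forall K : {set G}, clique K -> (#|K| <= r)%N.

Lemma spectral_turan :
  spectral_radius R G <= spectral_radius R (turan n r) /\
  (spectral_radius R G = spectral_radius R (turan n r) ->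
   isomorphic G (turan n r)).
Proof.
have G0 : (0 < gorder G)%N by rewrite G_order (leq_trans _ r_le_n) // ltnW.
have T0 := spectral_radius_turan_gt0 R r_ge2 r_le_n.
set a := spectral_radius R G.
have [a0|a0] := leP a 0.
  split; first exact: ltW (le_lt_trans a0 T0).
  by move=> aT; move: T0; rewrite -aT ltNge a0.
have [eG _] := spectral_radiusP R G0.
have [x [x0 X0] xG] := nonneg_subeigenfunction (ltW a0) eG.
have [p0 [p0r p0d p0e]] : exists p : G -> nat,
    [/\ forall v, (p v < r)%N,
        forall v, \sum_(u | edge u v) x u <= \sum_(u | p u != p v) x u
      & (forall v, 0 < x v) ->
        (forall v, \sum_(u | edge u v) x u = \sum_(u | p u != p v) x u) ->
        forall u v, edge u v = (p u != p v)].
  have [|p [pr pd pe]] := @multipartite_majorization R G x x0 r [set: G].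
    by move=> K _; apply: G_free.
  have sT (P : pred G) : \sum_(u in [set: G] | P u) x u = \sum_(u | P u) x u.
    by apply: eq_bigl => u; rewrite inE.
  exists p; split=> [v|v|x1 e1 u v]; first exact: pr.
    by have := pd v; rewrite !sT; apply; rewrite inE.
  by apply: pe => //; rewrite ?inE // => w _; rewrite !sT.
(* Missing colours count as parts of size 0, so both partitions have index type ['I_r]. *)
pose p v : 'I_r := Ordinal (p0r v).
have xp v : a * x v <= \sum_(u | p u != p v) x u := le_trans (xG v) (p0d v).
have SG := part_sum_ge1 a0 X0 xp.
have ST := balanced_sum_leif a0 (part_size_turan_balanced n r_ge2)
  (sum_part_size_turan r_ge2 p G_order).
have [aT aTeq] := spectral_radius_turan_ge r_le_n (ltW a0) (le_trans SG ST.1).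
(* Now [part_sum p a] lies between 1 and the Turán sum, which is 1, so both the weight inequalities
   and the concavity bound are tight. *)
split=> // /aTeq ST1.
have SG1 : part_sum p a = 1.
  by apply/eqP; rewrite eq_le SG andbT -ST1; exact: ST.1.
have xE := part_sum_eq1 a0 X0 xp SG1.
apply: (balanced_isomorphic_turan r_ge2 (p := p)) => //.
  apply: p0e => v; first by have [] := xE v.
  by apply/eqP; rewrite eq_le p0d /=; have [<- _] := xE v; apply: xG.
move=> i; have := ST.2; rewrite -/(part_sum p a) -/(part_sum _ a) SG1 ST1 eqxx.
by move=> /esym/forallP.
Qed.

End SpectralTuran.

Theorem theorem1 (R : realType) (n r : nat)
    (hr : (2 <= r)%N) (hrn : (r <= n)%N) :
  [/\ gorder (turan n r) = n, connected_graph (turan n r),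
      graph_rank R (turan n r) = r
    & forall G : sgraph,
        gorder G = n -> connected_graph G -> graph_rank R G = r ->
        spectral_radius R G <= spectral_radius R (turan n r) /\
        (spectral_radius R G = spectral_radius R (turan n r) <->
         isomorphic G (turan n r))].
Proof.
split; [exact: gorder_turan | exact: connected_turan | exact: graph_rank_turan |].
move=> G Gn [G0 _] Gr; have [|le eq_iso] := @spectral_turan R n r G hr hrn Gn.
  (* Cliques of order 1 escape the rank bound but satisfy [1 <= r]. *)
  move=> K cK; have [->|K1] := eqVneq #|K| 1%N; first exact: ltnW.
  by rewrite -Gr clique_card_le_rank.
by split=> //; split=> // /(isomorphic_spectral_radius R G0).
Qed.
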